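(* Let $\mathcal{A}$ be a finite alphabet and let $\Omega \subseteq \mathcal{A}^{\mathbb{Z}}$ be a minimal subshift. Then $R_{\mathrm{max}}(\Omega) = \max_{\omega \in \Omega} R(\omega)$ and $T_{\mathrm{max}}(\Omega) = \max_{\omega \in \Omega} T(\omega)$ both exist, as elements of $[1,\infty]$. Moreover, the sets $\{ \omega \in \Omega : R(\omega) = R_{\mathrm{max}}(\Omega) \}$ and $\{ \omega \in \Omega : T(\omega) = T_{\mathrm{max}}(\Omega) \}$ are residual in $\Omega$.
   Context: $\mathcal{A}$ carries the discrete topology and $\mathcal{A}^{\mathbb{Z}}$ the product topology. The shift $S$ on $\mathcal{A}^{\mathbb{Z}}$ is $(S\omega)_k = \omega_{k+1}$. A subshift is a closed, $S$-invariant subset $\Omega$ of $\mathcal{A}^{\mathbb{Z}}$; it is minimal if the $S$-orbit of every $\omega \in \Omega$ is dense in $\Omega$. For $\omega \in \mathcal{A}^{\mathbb{Z}}$ and $n \ge 1$ define $$R_n(\omega) = 1 + \frac{1}{n} \sup \{ m : \omega_k = \omega_{k+n} \text{ for } 1 \le k \le m \},$$ $$T_n(\omega) = 1 + \frac{1}{n} \sup \{ m : \omega_k = \omega_{k+n} \text{ and } \omega_{n+1-k} = \omega_{1-k} \text{ for } 1 \le k \le m \},$$ where $m$ ranges over positive integers and $\sup\emptyset = 0$, and set $R(\omega) = \limsup_{n\to\infty} R_n(\omega)$ and $T(\omega) = \limsup_{n \to \infty} T_n(\omega)$, which are elements of $[1,\infty]$. *)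

(* Defs.v *)
From mathcomp Require Export all_boot all_order all_algebra.
From mathcomp Require Export all_classical all_reals all_analysis.

Set Implicit Arguments.
Unset Strict Implicit.
Unset Printing Implicit Defensive.
Import Order.TTheory GRing.Theory Num.Theory.

Local Open Scope classical_set_scope.
Local Open Scope ring_scope.

Section Subshifts.
Variable A : finType.

Definition full_shift : topologicalType := {ptws int -> discrete_topology A}.

Definition shift (w : full_shift) : full_shift := fun k => w (k + 1).

(* the two-sided orbit {S^n w : n in Z}; S^(- n) w is the u with S^n u = w *)
Definition orbit (w : full_shift) : set full_shift :=
  [set u | exists n : nat, u = iter n shift w \/ iter n shift u = w].

Definition subshift (Omega : set full_shift) : Prop :=
  closed Omega /\ shift @` Omega = Omega.

(* A minimal subshift is nonempty by convention. *)
Definition minimal_subshift (Omega : set full_shift) : Prop :=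
  [/\ subshift Omega, Omega !=set0
    & forall w, Omega w -> Omega `<=` closure (orbit w)].

End Subshifts.

Section Exponents.
Variables (K : realType) (A : finType).
Implicit Type w : full_shift A.

Local Open Scope ereal_scope.

(* The supremum in [0, +oo], so that sup set0 = 0 (ereal_sup set0 = -oo). *)
Definition sup_nat (M : set nat) : \bar K :=
  maxe 0 (ereal_sup [set m%:R%:E | m in M]).

(* Only the values at n >= 1 are meaningful; n = 0 does not affect limsups. *)
Definition Rn w (n : nat) : \bar K :=
  1 + (n%:R^-1)%:E *
    sup_nat [set m : nat | (0 < m)%N /\
      forall k : nat, (1 <= k <= m)%N -> w k%:Z = w (k%:Z + n%:Z)%R].

Definition Tn w (n : nat) : \bar K :=
  1 + (n%:R^-1)%:E *
    sup_nat [set m : nat | (0 < m)%N /\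
      forall k : nat, (1 <= k <= m)%N ->
        w k%:Z = w (k%:Z + n%:Z)%R /\
        w (n%:Z + 1 - k%:Z)%R = w (1 - k%:Z)%R].

Definition Rlimsup w : \bar K := limn_esup (Rn w).

Definition Tlimsup w : \bar K := limn_esup (Tn w).

End Exponents.

Definition is_max (K : realType) (E : set (\bar K)) (x : \bar K) : Prop :=
  E x /\ ubound E x.

(* D contains a countable intersection of dense relatively open subsets of Y;
   the relatively open sets are written as traces Y `&` U n, with U n open. *)
Definition residual_in (X : topologicalType) (Y D : set X) : Prop :=
  exists U : nat -> set X,
    [/\ forall n, open (U n),
        forall n, Y `<=` closure (Y `&` U n)
      & \bigcap_n (Y `&` U n) `<=` D].

(* Main.v *)
Require Import Defs.
From mathcomp Require Import zify lra.

(** Both exponents have the form [1 + (1/n) sup (M w n)], where [M w n] is the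
set of the lengths [m] such that some word of [w] around the origin has period
[n].  Two features of [M] suffice: [m \in M w n] depends on finitely many
coordinates of [w], hence is an open condition, and one application of the
shift costs at most one unit of length.

By the first feature, [exceeds c N], the set of the points whose exponent is
above [c] for some [n >= N], is open ([exceeds_open]).  By the second one, if
the limsup at [w] is above [c], then every forward iterate of [w] lies in
[exceeds c N]: the loss [j/n] caused by [j] shifts tends to [0] with [1/n]
([exceeds_iter_shift]).  In a minimal subshift the forward orbit of each point
is dense ([forward_orbit_dense]), so [exceeds c N] is dense as soon as [c] is
below the supremum [x] over the subshift of the limsups ([exceeds_dense]).
Intersecting over [N] and over the rationals [c < x] gives a countable
intersection of dense relatively open sets on which the limsup is at least [x],
hence equal to [x].  It is nonempty by Baire's theorem ([baire]), so that [x] is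
a maximum, and it is contained in the set of the points that reach the maximum.

Forward iterates are used because the one-sided exponent can collapse under the
inverse shift, when the new first letter breaks the period. *)

Set Implicit Arguments.
Unset Strict Implicit.
Unset Printing Implicit Defensive.
Import Order.TTheory GRing.Theory Num.Theory.

Local Open Scope classical_set_scope.
Local Open Scope ring_scope.

(** * Topology of the full shift *)

Section FullShift.
Variable A : finType.
Implicit Types (w u v : full_shift A) (L : nat).

Definition cylinder w L : set (full_shift A) :=
  [set u | forall k : int, (`|k| <= L)%N -> u k = w k].

Lemma cylinder_refl w L : cylinder w L w.
Proof. by []. Qed.

Lemma cylinder_eq w u L : cylinder w L u -> cylinder u L = cylinder w L.
Proof.
move=> uw; apply/seteqP; split=> x xu k kL; first by rewrite xu// uw.
by rewrite xu// uw.
Qed.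

Lemma subset_cylinder w L L' : (L <= L')%N -> cylinder w L' `<=` cylinder w L.
Proof. by move=> LL' u uw k kL; apply: uw; exact: leq_trans LL'. Qed.

Lemma nbhs_coordinate w (k : int) : nbhs w [set u | u k = w k].
Proof.
exact: (@proj_continuous int (fun=> discrete_topology A) k w _
  (discrete_set1 (w k))).
Qed.

Lemma nbhs_cylinder w L : nbhs w (cylinder w L).
Proof.
elim: L => [|L IH].
  apply: filterS (nbhs_coordinate w 0) => u u0 k.
  by rewrite leqn0 absz_eq0 => /eqP ->.
have IHp : nbhs w (cylinder w L `&` [set u | u L.+1 = w L.+1]).
  exact: filterI IH (nbhs_coordinate w L.+1).
apply: filterS (filterI IHp (nbhs_coordinate w (- L.+1%:Z))).
move=> u [[uw up] un] k.
rewrite leq_eqVlt ltnS => /orP[/eqP kL|]; last exact: uw.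
have [k0|k0] := leP 0 k.
  have -> : k = L.+1 by lia.
  exact: up.
have -> : k = - L.+1%:Z by lia.
exact: un.
Qed.

(** The cylinders at [w] generate a filter that converges to [w] in each
coordinate, hence in the product topology: every neighbourhood of [w] contains
one of them. *)
Lemma nbhs_cylinderP w (U : set (full_shift A)) :
  nbhs w U <-> exists L, cylinder w L `<=` U.
Proof.
split=> [|[L LU]]; last exact: filterS LU (nbhs_cylinder w L).
pose F : set_system (full_shift A) := filter_from setT (cylinder w).
have FF : Filter F.
  apply: filter_from_filter => [|L L' _ _]; first by exists 0%N.
  exists (maxn L L') => // u uw; split; apply: subset_cylinder uw.
    exact: leq_maxl.
  exact: leq_maxr.
suff Fw : F --> w by move=> /Fw [L _ LU]; exists L.
apply/cvg_sup => k V /= [_ [[B _ <-] /= Bw BV]].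
by exists `|k|%N => // u /(_ k (leqnn _)) uk; apply: BV; rewrite /= uk.
Qed.

Definition shift_by (j : int) w : full_shift A := fun k => w (k + j).

Lemma iter_shift n w : iter n (@shift A) w = shift_by n w.
Proof.
elim: n => [|n IH]; first by apply/funext => k; rewrite /shift_by addr0.
rewrite iterS IH; apply/funext => k; rewrite /shift_by /shift.
by congr (w _); lia.
Qed.

Lemma shift_byD i j w : shift_by i (shift_by j w) = shift_by (i + j) w.
Proof. by apply/funext => k; rewrite /shift_by addrA. Qed.

Lemma orbitP w u : orbit w u <-> exists j, u = shift_by j w.
Proof.
split=> [[n [->|<-]]|[[n|n] ->]].
- by exists n; rewrite iter_shift.
- exists (- n%:Z); rewrite iter_shift shift_byD addNr.
  by apply/funext => k; rewrite /shift_by addr0.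
- by exists n; left; rewrite iter_shift.
- exists n.+1; right; rewrite iter_shift shift_byD NegzE subrr.
  by apply/funext => k; rewrite /shift_by addr0.
Qed.

Lemma nbhs_shift_by j w (V : set (full_shift A)) :
  nbhs (shift_by j w) V -> nbhs w (shift_by j @^-1` V).
Proof.
move=> /nbhs_cylinderP[L LV]; apply/nbhs_cylinderP; exists (L + `|j|)%N.
by move=> u uw; apply: LV => k kL; apply: uw; lia.
Qed.

Lemma subshift_iter (Omega : set (full_shift A)) w n :
  subshift Omega -> Omega w -> Omega (shift_by n%:Z w).
Proof.
move=> [_ sO] Ow; rewrite -iter_shift; elim: n => //= n IH.
by rewrite -sO; exists (iter n (@shift A) w).
Qed.

Lemma full_shift_compact : compact [set: full_shift A].
Proof.
have := @tychonoff int (fun=> discrete_topology A) (fun=> setT)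
  (fun=> @finite_compact (discrete_topology A) setT (@finite_finset A setT)).
by congr compact; apply/seteqP; split.
Qed.

(** Minimality speaks of two-sided orbits.  By compactness the forward orbit of
[w] accumulates at some [v] of [Omega]; some translate of [v], by a possibly
negative [j], is in [V], and then so is the same translate of a forward iterate
of [w] close to [v], whose index can be taken larger than [|j|]. *)
Lemma forward_orbit_dense (Omega V : set (full_shift A)) w :
  minimal_subshift Omega -> Omega w -> open V -> Omega `&` V !=set0 ->
  exists n : nat, V (shift_by n w).
Proof.
move=> [sO _ minO] Ow oV [x [Ox Vx]].
pose F := (fun n : nat => shift_by n w) @ \oo.
have FF : ProperFilter F by exact: fmap_proper_filter.
have [v [_ Fv]] := full_shift_compact FF filterT.
have Ov : Omega v.
  have [cO _] := sO; apply: cO => B Bv; apply: Fv Bv.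
  by exists 0%N => // n _; exact: subshift_iter.
have [_ [/orbitP[j ->] Vj]] := minO v Ov x Ox V (open_nbhs_nbhs (conj oV Vx)).
have Fj : F [set u | exists2 n : nat, (`|j| <= n)%N & u = shift_by n w].
  by exists `|j|%N => // n jn; exists n.
have [_ [[n jn ->] Vnj]] :=
  Fv _ _ Fj (nbhs_shift_by (open_nbhs_nbhs (conj oV Vj))).
exists `|(j + n%:Z)%R|%N; move: Vnj; rewrite /= shift_byD.
by congr (V (shift_by _ w)); lia.
Qed.

(** Baire's theorem in a closed set of sequences: nested cylinders play the part
of nested balls, and their centres stabilize on each coordinate, which gives
the common point with no appeal to compactness. *)
Lemma baire (Omega : set (full_shift A)) (U : nat -> set (full_shift A)) :
  closed Omega -> Omega !=set0 ->
  (forall i, open (U i)) -> (forall i, Omega `<=` closure (Omega `&` U i)) ->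
  \bigcap_i (Omega `&` U i) !=set0.
Proof.
move=> cO [w0 Ow0] oU dU.
(* The stage [i] is part of the argument of the choice function, because the
   cylinder chosen at that stage has to be inside [U i]. *)
have step (x : nat * full_shift A * nat) : exists y : full_shift A * nat,
    Omega x.1.2 -> [/\ (x.2 < y.2)%N, cylinder x.1.2 x.2 y.1
      & Omega y.1 /\ cylinder y.1 y.2 `<=` U x.1.1].
  case: x => [[i w] L] /=.
  have [Ow|] := pselect (Omega w); last by exists (w, L).
  have [u [[Ou Uu] uw]] := dU i w Ow _ (nbhs_cylinder w L).
  have /nbhs_cylinderP[L' L'U] := open_nbhs_nbhs (conj (oU i) Uu).
  exists (u, maxn L.+1 L') => _; split=> //=; first exact: leq_maxl.
  split=> //; apply: subset_trans L'U.
  by apply: subset_cylinder; exact: leq_maxr.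
have [f fP] := choice step.
pose s := fix s i : full_shift A * nat :=
  if i is j.+1 then f (j, (s j).1, (s j).2) else (w0, 0%N).
have Os i : Omega (s i).1.
  by elim: i => //= i IH; have [_ _ []] := fP (i, (s i).1, (s i).2) IH.
have sS i : [/\ ((s i).2 < (s i.+1).2)%N,
    cylinder (s i).1 (s i).2 (s i.+1).1
    & cylinder (s i.+1).1 (s i.+1).2 `<=` U i].
  by have [? ? []] := fP (i, (s i).1, (s i).2) (Os i).
have sL i : (i <= (s i).2)%N.
  by elim: i => // i IH; have [+ _ _] := sS i; exact: leq_ltn_trans.
have sC i j : (i <= j)%N ->
  cylinder (s j).1 (s j).2 `<=` cylinder (s i).1 (s i).2.
  move=> /subnK <-; elim: (j - i)%N => // d IH; rewrite addSn.
  have [lt sc _] := sS (d + i)%N; apply: subset_trans IH.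
  by rewrite -(cylinder_eq sc); apply: subset_cylinder; exact: ltnW.
(* Stage [|k|] already fixes the coordinate [k], since its radius is at least
   [|k|]. *)
pose w : full_shift A := fun k => (s `|k|%N).1 k.
have ws i : cylinder (s i).1 (s i).2 w.
  move=> k kL; rewrite /w; have [ik|/ltnW ki] := leqP i `|k|%N.
    exact: (sC _ _ ik (s `|k|%N).1).
  by have /(_ _ (sL _)) := sC _ _ ki (s i).1 (@cylinder_refl _ _).
have Ow : Omega w.
  apply: cO => B /nbhs_cylinderP[L LB]; exists (s L).1; split=> //.
  by apply: LB => k kL; rewrite (ws L)//; exact: leq_trans (sL L).
by exists w => i _; split=> //; have [_ _] := sS i; apply.
Qed.

End FullShift.

(** * Limsups and exponents *)

Section ExtendedReals.
Variable K : realType.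
Local Open Scope ereal_scope.

Lemma rat_between (x y : \bar K) : x < y ->
  exists q : rat, x < (ratr q)%:E < y.
Proof.
case: x y => [x| |] [y| |] //=; rewrite ?lte_fin => xy.
- have [q] := rat_in_itvoo xy; rewrite in_itv /= => /andP[xq qy].
  by exists q; rewrite !lte_fin xq.
- have /rat_in_itvoo[q] : (x < x + 1)%R by rewrite ltrDl.
  by rewrite in_itv /= => /andP[xq _]; exists q; rewrite lte_fin xq ltry.
- have /rat_in_itvoo[q] : (y - 1 < y)%R by rewrite gtrBl.
  by rewrite in_itv /= => /andP[_ qy]; exists q; rewrite ltNyr lte_fin.
- by exists 0%R; rewrite ltNyr ltry.
Qed.

Lemma lt_limn_esup (u : (\bar K)^nat) (c : \bar K) (N : nat) :
  c < limn_esup u -> exists2 n, (N <= n)%N & c < u n.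
Proof.
move=> cu.
have /ereal_sup_gt[_ [n /= Nn <-] cn] :
    c < ereal_sup (u @` [set n | (N <= n)%N]).
  apply: lt_le_trans cu _; apply: ereal_inf_lbound.
  by exists [set n | (N <= n)%N] => //; exists N.
by exists n.
Qed.

Lemma le_limn_esup (u : (\bar K)^nat) (c : \bar K) :
  (forall N, exists2 n, (N <= n)%N & c <= u n) -> c <= limn_esup u.
Proof.
move=> H; apply: le_ereal_inf_tmp => _ [V [N _ NV] <-].
have [n Nn cn] := H N; apply: le_trans cn _; apply: ereal_sup_ubound.
by exists n => //; exact: NV.
Qed.

Definition exponent (M : nat -> set nat) (n : nat) : \bar K :=
  1 + (n%:R^-1)%:E * sup_nat K (M n).

Lemma exponent_ge1 M n : 1 <= exponent M n.
Proof. by rewrite leeDl// mule_ge0 ?lee_fin// le_max lexx. Qed.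

(** Removes the extended supremum: exceeding [c] is witnessed by a single
length [m].  The first alternative covers the empty set of lengths, for which
the exponent is [1]; the value at [n = 0] is also [1] since [0^-1 = 0]. *)
Lemma lt_exponent M n (c : K) : c%:E < exponent M n <->
  (c < 1)%R \/ exists2 m, M n m & (c < 1 + m%:R / n%:R)%R.
Proof.
split; last first.
  case=> [c1|[m Mm cm]].
    by apply: lt_le_trans (exponent_ge1 M n); rewrite lte_fin.
  have : (c%:E < (1 + m%:R / n%:R)%:E) by rewrite lte_fin.
  move/lt_le_trans; apply; rewrite /exponent EFinD leeD2l// mulrC EFinM.
  rewrite lee_wpmul2l ?lee_fin ?invr_ge0// le_max; apply/orP; right.
  by apply: ereal_sup_ubound; exists m.
move=> cE; have [c1|c1] := ltP c 1%R; [by left|right].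
have n0 : (0 < n)%N.
  rewrite lt0n; apply/eqP => n0; move: cE.
  by rewrite /exponent n0 invr0 mul0e adde0 lte_fin ltNge c1.
have nR : (0 < n%:R :> K)%R by rewrite ltr0n.
have : (n%:R * (c - 1))%:E < sup_nat K (M n).
  move: cE; rewrite /exponent.
  rewrite -lteBlDl// -EFinB => cE.
  by rewrite EFinM -lte_pdivlMl.
rewrite /sup_nat lt_max => /orP[|/ereal_sup_gt[_ [m Mm <-]]].
  by rewrite lte_fin ltNge mulr_ge0 ?subr_ge0.
rewrite lte_fin => nm; exists m => //.
by rewrite -ltrBlDl ltr_pdivlMr// mulrC.
Qed.
End ExtendedReals.

(** * The maximal limsup of a shift-stable exponent *)

Section Maximum.
Variables (K : realType) (A : finType) (Omega : set (full_shift A)).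
Variable M : full_shift A -> nat -> set nat.
Hypothesis openM : forall n m, open [set w | M w n m].
Hypothesis shiftM : forall w n m, (0 < m)%N -> M w n m.+1 -> M (shift w) n m.
Hypothesis minOmega : minimal_subshift Omega.
Local Open Scope ereal_scope.

Let E w n := exponent K (M w) n.

Definition exceeds (c : K) (N : nat) : set (full_shift A) :=
  [set w | exists2 n, (N <= n)%N & c%:E < E w n].

Lemma exceeds_open c N : open (exceeds c N).
Proof.
rewrite openE => w [n Nn /lt_exponent[c1|[m Mm cm]]].
  by apply: filterE => u; exists n => //; apply/lt_exponent; left.
have : nbhs w [set u | M u n m] by exact: open_nbhs_nbhs.
by apply: filterS => u Mu; exists n => //; apply/lt_exponent; right; exists m.
Qed.

Lemma iter_shiftM w n m j :
  (0 < m)%N -> M w n (m + j)%N -> M (iter j (@shift A) w) n m.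
Proof.
elim: j m => [|j IH] m m0; first by rewrite addn0.
by rewrite -addSnnS => Mm; apply: shiftM => //; exact: IH.
Qed.

(** If the limsup at [w] is above some [d > c], a length [m] with
[m/n > d - 1] is left with [m - j] after [j] shifts, and
[(m - j)/n > d - 1 - j/n >= c - 1] as soon as [n >= j / (d - c)]. *)
Lemma exceeds_iter_shift w c N j :
  c%:E < limn_esup (E w) -> exceeds c N (iter j (@shift A) w).
Proof.
move=> /rat_between[q /andP[]]; set d : K := ratr q; rewrite lte_fin => cd dw.
have [k kP] : exists k : nat, (j%:R <= k%:R * (d - c))%R.
  exists (Num.Def.archi_bound (j%:R / (d - c))).
  rewrite -ler_pdivrMr ?subr_gt0//; apply: ltW; apply: archi_boundP.
  by rewrite divr_ge0// subr_ge0 ltW.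
have [n nk /lt_exponent dE] := lt_limn_esup (maxn N k.+1) dw.
exists n; first by apply: leq_trans nk; exact: leq_maxl.
have {}nk : (k < n)%N by apply: leq_trans nk; exact: leq_maxr.
apply/lt_exponent; have [c1|c1] := ltP c 1%R; [by left|right].
case: dE => [d1|[m Mm dm]].
  by move: (lt_le_trans d1 c1); rewrite ltNge (ltW cd).
have nR : (0 < n%:R :> K)%R by rewrite ltr0n; lia.
have kn : (k%:R * (d - c) <= n%:R * (d - c))%R.
  by rewrite ler_pM2r ?subr_gt0// ler_nat ltnW.
have cn : (0 <= n%:R * (c - 1))%R by rewrite mulr_ge0// subr_ge0.
have {}dm : (n%:R * (d - 1) < m%:R)%R.
  by rewrite mulrC -ltr_pdivlMr// ltrBlDl.
have jm : (j < m)%N by rewrite -(ltr_nat K); lra.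
exists (m - j)%N.
  by apply: iter_shiftM; rewrite ?subn_gt0// subnK// ltnW.
rewrite -ltrBlDl ltr_pdivlMr// natrB; last exact: ltnW.
lra.
Qed.

Lemma exceeds_dense w c N : Omega w -> c%:E < limn_esup (E w) ->
  Omega `<=` closure (Omega `&` exceeds c N).
Proof.
move=> Ow cw x Ox B; rewrite nbhsE => -[V [oV Vx] VB].
have [n Vn] := forward_orbit_dense minOmega Ow oV (ex_intro _ x (conj Ox Vx)).
exists (shift_by n w); split; last exact: VB.
split; first by apply: subshift_iter => //; case: minOmega.
by rewrite -iter_shift; exact: exceeds_iter_shift.
Qed.

(** Points of all the sets [U i] have limsup at least [q] for every rational
[q] below the supremum [x]; these sets are dense and open, so that Baire's
theorem yields at once the residual set and a point where [x] is reached. *)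
Lemma residual_max : exists x : \bar K,
  [/\ 1 <= x, is_max [set limn_esup (E w) | w in Omega] x
    & residual_in Omega [set w | Omega w /\ limn_esup (E w) = x]].
Proof.
have [[cO _] O0 _] := minOmega.
pose x := ereal_sup [set limn_esup (E w) | w in Omega].
have xub w : Omega w -> limn_esup (E w) <= x.
  by move=> Ow; apply: ereal_sup_ubound; exists w.
pose U i : set (full_shift A) :=
  if unpickle i is Some (q, N) then
    if (ratr q)%:E < x then exceeds (ratr q) N else setT
  else setT.
have oU i : open (U i).
  rewrite /U; case: unpickle => [[q N]|]; last exact: openT.
  by case: ifP => _; [exact: exceeds_open|exact: openT].
have dT : Omega `<=` closure (Omega `&` setT).
  by rewrite setIT; exact: subset_closure.
have dU i : Omega `<=` closure (Omega `&` U i).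
  rewrite /U; case: unpickle => [[q N]|//]; case: ifP => // qx.
  by have [_ [w Ow <-] qw] := ereal_sup_gt qx; exact: exceeds_dense qw.
have Ux : \bigcap_i (Omega `&` U i) `<=`
    [set w | Omega w /\ limn_esup (E w) = x].
  move=> w Uw; have [Ow _] := Uw 0%N I; split=> //.
  apply/eqP; rewrite eq_le xub//= leNgt; apply/negP.
  move=> /rat_between[q /andP[wq qx]].
  suff : (ratr q)%:E <= limn_esup (E w) by rewrite leNgt wq.
  apply: le_limn_esup => N; have [_] := Uw (pickle (q, N)) I.
  by rewrite /U pickleK qx => -[n Nn /ltW]; exists n.
have [w /Ux[Ow wx]] := baire cO O0 oU dU.
exists x; split; last by exists U.
- rewrite -wx; apply: le_limn_esup => N; exists N => //; exact: exponent_ge1.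
- by split=> [|_ [u Ou <-]]; [exists w|exact: xub].
Qed.

End Maximum.

(** * The two families of periods *)

Section Repetitions.
Variable A : finType.

(** The [m > 0] such that the word [w_1 .. w_(n+m)] has period [n]. *)
Definition forward_period (w : full_shift A) (n : nat) : set nat :=
  [set m : nat | (0 < m)%N /\
      forall k : nat, (1 <= k <= m)%N -> w k%:Z = w (k%:Z + n%:Z)%R].

(** The [m > 0] such that the word [w_(1-m) .. w_(n+m)] has period [n]. *)
Definition two_sided_period (w : full_shift A) (n : nat) : set nat :=
  [set m : nat | (0 < m)%N /\
      forall k : nat, (1 <= k <= m)%N ->
        w k%:Z = w (k%:Z + n%:Z)%R /\
        w (n%:Z + 1 - k%:Z)%R = w (1 - k%:Z)%R].

Lemma open_forward_period n m : open [set w | forward_period w n m].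
Proof.
rewrite openE => w [m0 H]; apply/nbhs_cylinderP; exists (n + m).+1 => u uw.
by split=> // k km; rewrite !uw; [exact: H|lia|lia].
Qed.

Lemma open_two_sided_period n m : open [set w | two_sided_period w n m].
Proof.
rewrite openE => w [m0 H]; apply/nbhs_cylinderP; exists (n + m).+1 => u uw.
by split=> // k km; rewrite !uw; [exact: H|lia|lia|lia|lia].
Qed.

Lemma shift_forward_period w n m : (0 < m)%N ->
  forward_period w n m.+1 -> forward_period (shift w) n m.
Proof.
move=> m0 [_ H]; split=> // k km; rewrite /shift.
have := H k.+1 ltac:(lia).
by congr (_ = _); congr (w _); lia.
Qed.

(** A shift moves one position from the right of the origin to its left, so the
first left condition for [shift w] is a right condition for [w], and the other
left conditions are old ones with a smaller index. *)
Lemma shift_two_sided_period w n m : (0 < m)%N ->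
  two_sided_period w n m.+1 -> two_sided_period (shift w) n m.
Proof.
move=> m0 [_ H]; split=> // k km; rewrite /shift; split.
  have [+ _] := H k.+1 ltac:(lia).
  by congr (_ = _); congr (w _); lia.
(* For [k = 1] the left condition is [w_(n+1) = w_1], the old right one. *)
case: k km => // -[_|k km].
  have [+ _] := H 1%N ltac:(lia); move/esym.
  by congr (_ = _); congr (w _); lia.
have [_ +] := H k.+1 ltac:(lia).
by congr (_ = _); congr (w _); lia.
Qed.

End Repetitions.

Local Open Scope ereal_scope.

Theorem proposition1 (K : realType) (A : finType) (Omega : set (full_shift A))
    (hOmega : minimal_subshift Omega) :
  exists Rmax Tmax : \bar K,
    [/\ 1 <= Rmax /\ 1 <= Tmax,
        is_max [set Rlimsup K w | w in Omega] Rmax,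
        is_max [set Tlimsup K w | w in Omega] Tmax,
        residual_in Omega [set w | Omega w /\ Rlimsup K w = Rmax]
      & residual_in Omega [set w | Omega w /\ Tlimsup K w = Tmax]].
Proof.
have [x [x1 xmax xres]] := residual_max K (@open_forward_period A)
  (@shift_forward_period A) hOmega.
have [y [y1 ymax yres]] := residual_max K (@open_two_sided_period A)
  (@shift_two_sided_period A) hOmega.
by exists x, y.
Qed.
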